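(* Let $\nu$ be a semi-algebraic norm on $\mathbb{R}^n$ such that $\nu$ and its dual norm $\nu^*$ are differentiable, and let $C\subset\mathbb{R}^n$ be an irreducible real algebraic variety. Let $\Omega_\nu(C)$ and $\mathrm{Sing}\,C$ be as defined in the context. Assume that $\Omega_\nu(C)\setminus(\mathbb{R}^n\times\mathrm{Sing}\,C)=\bigcup_{i=1}^N\Theta_i$ is a smooth semi-algebraic Whitney stratification. Suppose that for $i=1,\ldots,M$ each $\Theta_i$ is an open semi-algebraic subset of the set of smooth points of an irreducible variety $V_i\subset\mathbb{R}^n\times\mathbb{R}^n$ of dimension $n$, and that for $i>M$ each $\Theta_i$ has dimension less than $n$. Denote by $V_{i,\mathbb{C}}\subset\mathbb{C}^n\times\mathbb{C}^n$ the complexification of $V_i$, and let $\pi:\mathbb{C}^n\times\mathbb{C}^n\to\mathbb{C}^n$ be the projection on the first $n$ coordinates. Then the projection $\pi:V_{i,\mathbb{C}}\to\mathbb{C}^n$ is dominating for $i=1,\ldots,M$.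
   Context: A norm $\nu$ on $\mathbb{R}^n$ is semi-algebraic if its graph is a semi-algebraic subset of $\mathbb{R}^{n+1}$. The dual norm is $\nu^*(\mathbf{x})=\max\{\mathbf{y}^\top\mathbf{x}:\nu(\mathbf{y})=1\}$. A norm is called differentiable if it is differentiable at every $\mathbf{x}\neq\mathbf{0}$. For closed $C$, $\mathrm{dist}_\nu(\mathbf{x},C)=\min\{\nu(\mathbf{x}-\mathbf{y}):\mathbf{y}\in C\}$; a best $\nu$-approximation of $\mathbf{x}$ is a point of $C$ attaining this minimum; $S(C)$ is the set of $\mathbf{x}\in\mathbb{R}^n$ whose best $\nu$-approximation in $C$ is not unique; and $$\Omega_\nu(C)=\{(\mathbf{x},\mathbf{z}):\ \mathbf{x}\in\mathbb{R}^n\setminus S(C),\ \mathbf{z}\in C,\ \mathrm{dist}_\nu(\mathbf{x},C)=\nu(\mathbf{x}-\mathbf{z})\}.$$ For an irreducible variety $V\subset\mathbb{F}^n$ ($\mathbb{F}=\mathbb{R}$ or $\mathbb{C}$) with vanishing ideal generated by $p_1,\ldots,p_s$, let $D(V)(\mathbf{y})$ be the $n\times s$ matrix whose columns are the gradients of $p_1,\dots,p_s$ at $\mathbf{y}$. The dimension $d$ of $V$ is $n-\max_{\mathbf{y}\in V}\mathrm{rank}\,D(V)(\mathbf{y})$. A point $\mathbf{y}\in V$ is smooth if $\mathrm{rank}\,D(V)(\mathbf{y})=n-d$ and singular otherwise; $\mathrm{Sing}\,V$ is the set of singular points. If $V$ is a real irreducible variety, its complexification $V_{\mathbb{C}}$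 is the common complex zero locus of $p_1,\ldots,p_s$. A semi-algebraic set is called smooth if it is an open subset of the set of smooth points of some irreducible (real) algebraic set. A smooth semi-algebraic Whitney stratification of a semi-algebraic set is a finite partition into smooth semi-algebraic sets satisfying the Whitney conditions. A map from an irreducible complex variety to $\mathbb{C}^n$ is dominating (dominant) if its image is Zariski dense in $\mathbb{C}^n$. *)

(* Defs.v *)
From HB Require Import structures.
From mathcomp Require Import all_boot all_order all_algebra.
From mathcomp Require Import all_classical all_reals all_analysis.
From mathcomp Require Import complex.
From mathcomp Require Import -(notations) mpoly.

Set Implicit Arguments.
Unset Strict Implicit.
Unset Printing Implicit Defensive.

Import Order.TTheory GRing.Theory Num.Theory.
Import numFieldNormedType.Exports.

Local Open Scope classical_set_scope.
Local Open Scope ring_scope.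

(* Points of F^n are row vectors; a point (x, z) of F^n x F^n is the row      *)
(* vector row_mx x z, with x = lsubmx (row_mx x z), z = rsubmx (row_mx x z).  *)

Section AlgebraicSets.
Variables (F : fieldType) (n : nat).

Definition peval (p : mpoly n F) (x : 'rV[F]_n) : F :=
  meval (fun i => x 0 i) p.

Definition zero_locus (ps : seq (mpoly n F)) : set 'rV[F]_n :=
  [set x | forall p, p \in ps -> peval p x = 0].

Definition algebraic_set (A : set 'rV[F]_n) : Prop :=
  exists ps, A = zero_locus ps.

Definition irreducible_set (V : set 'rV[F]_n) : Prop :=
  V !=set0 /\
  forall A B : set 'rV[F]_n, algebraic_set A -> algebraic_set B ->
    V `<=` A `|` B -> V `<=` A \/ V `<=` B.

Definition zariski_dense (X : set 'rV[F]_n) : Prop :=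
  forall A : set 'rV[F]_n, algebraic_set A -> X `<=` A -> A = setT.

Definition vanishing_ideal (V : set 'rV[F]_n) : set (mpoly n F) :=
  [set f | forall x, V x -> peval f x = 0].

Definition ideal_gen (ps : seq (mpoly n F)) : set (mpoly n F) :=
  [set f | exists q : 'I_(size ps) -> mpoly n F, f = \sum_i q i * ps`_i].

(* The generators are part of the data because the Jacobian matrix and the    *)
(* complexification are written with them. Every irreducible algebraic set    *)
(* has some, by Hilbert's basis theorem.                                      *)
Record irr_variety := IrrVariety {
  points :> set 'rV[F]_n;
  gens : seq (mpoly n F);
  points_algebraic : algebraic_set points;
  points_irreducible : irreducible_set points;
  gensP : vanishing_ideal points = ideal_gen gens
}.

Definition jacobian (V : irr_variety) (y : 'rV[F]_n) :
    'M[F]_(n, size (gens V)) :=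
  \matrix_(i, j) peval (mderiv i (gens V)`_j) y.

Definition generic_rank (V : irr_variety) : nat :=
  \max_(r < n.+1 | `[< exists2 y, points V y & \rank (jacobian V y) = r >]) r.

Definition variety_dim (V : irr_variety) : nat := (n - generic_rank V)%N.

Definition smooth_points (V : irr_variety) : set 'rV[F]_n :=
  [set y | points V y /\ \rank (jacobian V y) = (n - variety_dim V)%N].

Definition Sing (V : irr_variety) : set 'rV[F]_n :=
  points V `\` smooth_points V.

End AlgebraicSets.

Definition complexification (R : realType) (n : nat) (V : irr_variety R n) :
    set 'rV[R[i]]_n :=
  zero_locus (map (map_mpoly (real_complex R)) (gens V)).

Definition dominating (F : fieldType) (m n : nat)
    (f : 'rV[F]_m -> 'rV[F]_n) (V : set 'rV[F]_m) : Prop :=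
  zariski_dense (f @` V).

Inductive semialgebraic (R : realType) (n : nat) : set 'rV[R]_n -> Prop :=
| semialgebraic_pos (p : mpoly n R) : semialgebraic [set x | 0 < peval p x]
| semialgebraic_setC A : semialgebraic A -> semialgebraic (~` A)
| semialgebraic_setU A B :
    semialgebraic A -> semialgebraic B -> semialgebraic (A `|` B).

Section Norms.
Variables (R : realType) (n : nat).
Implicit Types (nu : 'rV[R]_n -> R) (C : set 'rV[R]_n).

(* Nonnegativity follows from these three axioms.                             *)
Definition is_norm nu : Prop :=
  [/\ forall x y, nu (x + y) <= nu x + nu y,
      forall (a : R) x, nu (a *: x) = `|a| * nu x &
      forall x, nu x = 0 -> x = 0].

Definition semialgebraic_fun nu : Prop :=
  semialgebraic [set w : 'rV[R]_(n + 1) | rsubmx w = (nu (lsubmx w))%:M].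

(* For a norm and n > 0 this sup is a max: the unit sphere is compact.        *)
Definition dual_norm nu : 'rV[R]_n -> R :=
  fun x => sup [set (y *m x^T) 0 0 | y in [set y | nu y = 1]].

Definition differentiable_norm nu : Prop :=
  forall x : 'rV[R]_n, x != 0 -> differentiable nu x.

(* For a norm and a nonempty closed C this inf is a min.                      *)
Definition dist_to nu (x : 'rV[R]_n) C : R := inf [set nu (x - y) | y in C].

Definition best_approx nu C (x : 'rV[R]_n) : set 'rV[R]_n :=
  [set z | C z /\ dist_to nu x C = nu (x - z)].

Definition nonunique_approx nu C : set 'rV[R]_n :=
  [set x | ~ exists! z, best_approx nu C x z].

Definition Omega nu C : set 'rV[R]_(n + n) :=
  [set w | ~ nonunique_approx nu C (lsubmx w) /\
           best_approx nu C (lsubmx w) (rsubmx w)].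

End Norms.

Section Stratifications.
Variables (R : realType) (m : nat).
Implicit Types (X Y S : set 'rV[R]_m) (V : irr_variety R m).

(* X is open in smooth_points V for the Euclidean topology.                   *)
Definition open_in_smooth V X : Prop :=
  exists2 U : set 'rV[R]_m, open U & X = U `&` smooth_points V.

Definition smooth_semialgebraic X : Prop :=
  semialgebraic X /\ exists V, open_in_smooth V X.

(* When X is nonempty, V in the next two definitions is necessarily the       *)
(* Zariski closure of X, so the dimension and tangent spaces are unique.      *)
Definition has_dim X (d : nat) : Prop :=
  exists2 V, open_in_smooth V X & variety_dim V = d.

(* Linear subspaces of R^m are row spaces of matrices. The row space of       *)
(* kermx (jacobian V y) is the set of v orthogonal to all gradients at y.     *)
Definition tangent_space X (y : 'rV[R]_m) (T : 'M[R]_m) : Prop :=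
  exists2 V, open_in_smooth V X & (T == kermx (jacobian V y))%MS.

(* Convergence in the Grassmannian, as the quotient of the space of d-frames. *)
Definition subspace_cvg (p q : nat) (T_ : nat -> 'M[R]_(p, m))
    (T : 'M[R]_(q, m)) : Prop :=
  exists (d : nat) (B_ : nat -> 'M[R]_(d, m)) (B : 'M[R]_(d, m)),
    [/\ forall k, row_free (B_ k) /\ (B_ k == T_ k)%MS,
        row_free B /\ (B == T)%MS &
        B_ @ \oo --> B].

(* Y is the small stratum, in the closure of the big stratum X.               *)
Definition whitney_a X Y : Prop :=
  forall (y : 'rV[R]_m) (x_ : nat -> 'rV[R]_m) (T_ : nat -> 'M[R]_m)
         (T TY : 'M[R]_m),
    Y y -> (forall k, X (x_ k)) -> x_ @ \oo --> y ->
    (forall k, tangent_space X (x_ k) (T_ k)) -> subspace_cvg T_ T ->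
    tangent_space Y y TY ->
    (TY <= T)%MS.

Definition whitney_b X Y : Prop :=
  forall (y : 'rV[R]_m) (x_ y_ : nat -> 'rV[R]_m) (T_ : nat -> 'M[R]_m)
         (T : 'M[R]_m) (l : 'rV[R]_m),
    Y y -> (forall k, X (x_ k)) -> (forall k, Y (y_ k)) ->
    x_ @ \oo --> y -> y_ @ \oo --> y ->
    (forall k, tangent_space X (x_ k) (T_ k)) -> subspace_cvg T_ T ->
    subspace_cvg (fun k => x_ k - y_ k) l ->
    (l <= T)%MS.

Definition smooth_whitney_stratification (N : nat)
    (Theta : 'I_N -> set 'rV[R]_m) S : Prop :=
  [/\ classical_sets.partition setT Theta S,
      forall i, smooth_semialgebraic (Theta i) &
      forall i j, i != j -> whitney_a (Theta i) (Theta j) /\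
                            whitney_b (Theta i) (Theta j)].

End Stratifications.

(* Main.v *)
Require Import Defs.
From HB Require Import structures.
From mathcomp Require Import all_boot all_order all_algebra.
From mathcomp Require Import all_classical all_reals all_analysis.
From mathcomp Require Import complex.
From mathcomp Require Import -(notations) ssrcomplements mpoly.
From mathcomp Require Import zify ring lra.

Set Implicit Arguments.
Unset Strict Implicit.
Unset Printing Implicit Defensive.

Import Order.TTheory GRing.Theory Num.Theory.
Import numFieldNormedType.Exports.
Local Open Scope classical_set_scope.
Local Open Scope ring_scope.

(** A stratum Theta of dimension n is a nonempty set U `&` smooth_points V with U
    open, and the projection to the first n coordinates is injective on it,
    because a point of Omega is determined by its first half. These two
    properties force the projection of V to be Zariski dense.

    Write A(y) for the matrix of gradients of the generators of the ideal of V
    ([grad_gens]), of rank n at smooth points and at most n on V, and B(y) for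
    A(y) together with the gradients dx_1, ..., dx_n of the first coordinates
    ([grad_proj]). The tangent map of the projection at a smooth point y is onto
    exactly when B(y) has full rank n + n.

    If B has full rank at one point of V, the projection is dominating
    ([fst_dense_of_rank]). Indeed let f(x) vanish on V. At a point of full rank
    the differential of f is a combination both of the rows of A and of the
    dx_i, and these two row spaces meet in 0; so all partial derivatives of f
    vanish there. Full rank is a Zariski open condition and V is irreducible, so
    the partial derivatives of f vanish on V as well, and by induction on the
    degree f = 0. A complex polynomial vanishing on the projection of the
    complexification is handled through its real and imaginary parts, restricted
    to the real points.

    It remains to find a point of full rank ([immersed_point]). Otherwise choose
    y0 in Theta where the rank of B on Theta is maximal, but smaller than n + n.
    Cramer's rule gives a polynomial vector field W, nonzero at y0, that
    annihilates the rows of A at all points of V and the rows of B at all points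
    of Theta ([annihilating_field]). The flow of W from y0 stays in V, hence in
    Theta for small times, and there dx_i (W) = 0 keeps the first coordinates
    fixed while W(y0) <> 0 makes the point move: this contradicts injectivity.

    The flow is built as a Lie series ([polynomial_flow]): for a polynomial g put
    F_g(t) = \sum_k t^k / k! (W^k g)(y0), where W acts as a derivation. By the
    Leibniz rule g |-> F_g(t) is a ring morphism, so it is evaluation at a point
    y(t). As W maps the ideal of V into itself, F_g = 0 for every g in the ideal,
    so that y(t) lies in V. *)

(** * Linear algebra over the ring of polynomials *)

Lemma row_free_col_mx (F : fieldType) p q m (A : 'M[F]_(p, m))
    (B : 'M[F]_(q, m)) : row_free (col_mx A B) -> row_free A /\ row_free B.
Proof.
rewrite /row_free -addsmxE => /eqP rkAB.
have := mxrank_adds_leqif A B; rewrite rkAB => -[leAB _].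
have := rank_leq_row A; have := rank_leq_row B.
by split; apply/eqP; lia.
Qed.

Lemma det_col_mx_eq0 (F : fieldType) p q (A : 'M[F]_(p, p + q))
    (B : 'M[F]_(q, p + q)) : (\rank A < p)%N -> \det (col_mx A B) = 0.
Proof.
move=> ltAp; apply/eqP; apply: contraTT ltAp => det_neq0; rewrite -leqNgt.
suff /row_free_col_mx[/eqP-> _] : row_free (col_mx A B) by [].
by rewrite row_free_unit unitmxE unitfE.
Qed.

Lemma submx_col_mxl (F : fieldType) p q r m (X : 'M[F]_(p, m))
    (A : 'M[F]_(q, m)) (B : 'M[F]_(r, m)) :
  (X <= A)%MS -> (X <= col_mx A B)%MS.
Proof. by move=> sXA; rewrite -addsmxE (submx_trans sXA) ?addsmxSl. Qed.

Lemma submx_col_mxr (F : fieldType) p q r m (X : 'M[F]_(p, m))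
    (A : 'M[F]_(q, m)) (B : 'M[F]_(r, m)) :
  (X <= B)%MS -> (X <= col_mx A B)%MS.
Proof. by move=> sXB; rewrite -addsmxE (submx_trans sXB) ?addsmxSr. Qed.

(** A basis of the whole space adapted to A <= B: the vector e and the rows of
    E are constant and complement B, the others are explicit combinations of the
    rows of A and of B. When A and B depend on parameters these formulas extend
    the basis to nearby parameters. The vector e exists because B is not
    everything; its slot is the one that gets varied in Cramer's rule. *)
Lemma basis_through_subspaces (F : fieldType) m s k (A : 'M[F]_(s, m))
    (B : 'M[F]_(k, m)) :
    (A <= B)%MS -> (\rank B < m)%N ->
  exists r2 r3 (e : 'rV[F]_m) (P : 'M[F]_(\rank A, s)) (Q : 'M[F]_(r2, k))
      (E : 'M[F]_(r3, m)),
    [/\ (1 + \rank A + r2 + r3)%N = m, (\rank A + r2)%N = \rank B &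
        row_full (col_mx (col_mx (col_mx e (P *m A)) (Q *m B)) E)].
Proof.
move=> sAB ltBm.
have [P defP] : exists P, row_base A = P *m A.
  by apply/submxP; rewrite eq_row_base.
have [Q defQ] : exists Q, row_base (B :\: A)%MS = Q *m B.
  by apply/submxP; rewrite eq_row_base diffmxSl.
have rkD : (\rank A + \rank (B :\: A)%MS)%N = \rank B.
  by rewrite -(mxrank_cap_compl B A) (capmx_idPr sAB).
have [p rkU [U defU]] : exists2 p, (p.+1 + \rank B)%N = m &
    exists U : 'M[F]_(1 + p, m), (U :=: B^C)%MS.
  have := mxrank_compl B; move: (row_base B^C%MS) (eq_row_base B^C%MS).
  case: (\rank B^C%MS) => [|p] U defU.
    by move/esym/eqP; rewrite subn_eq0 leqNgt ltBm.
  by move=> rkE; exists p; [rewrite rkE subnK // ltnW | exists U].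
exists (\rank (B :\: A)%MS), p, (usubmx U), P, Q, (dsubmx U); split=> //.
  by apply: etrans rkU; rewrite -rkD -!addnA add1n addnA addnC.
rewrite -defP -defQ -sub1mx.
apply: submx_trans (_ : (B + B^C <= _)%MS).
  by rewrite sub1mx addsmx_compl_full.
rewrite addsmx_sub -defU; apply/andP; split; last first.
  rewrite -{1}[U]vsubmxK -addsmxE addsmx_sub.
  by apply/andP; split; [do 3!apply: submx_col_mxl | apply: submx_col_mxr].
apply: submx_trans (_ : (A + (B :\: A) <= _)%MS).
  by rewrite -{1}(addsmx_diff_cap_eq B A) addsmxC addsmxS // capmxSr.
rewrite addsmx_sub; apply/andP; split; apply: submx_col_mxl.
  by apply/submx_col_mxl/submx_col_mxr; rewrite eq_row_base.
by apply: submx_col_mxr; rewrite eq_row_base.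
Qed.

(** The determinants on the right are the components of the field that
    [annihilating_field] builds by Cramer's rule. *)
Lemma det_first_row_linear (T : comNzRingType) a b c
    (A : 'M[T]_(a, 1 + a + b + c)) (B : 'M[T]_(b, 1 + a + b + c))
    (E : 'M[T]_(c, 1 + a + b + c)) (v : 'rV[T]_(1 + a + b + c)) :
  \det (col_mx (col_mx (col_mx v A) B) E) =
  \sum_k v 0 k *
    \det (col_mx (col_mx (col_mx (delta_mx 0 k : 'rV[T]_(1 + a + b + c)) A) B) E).
Proof.
pose i0 : 'I_(1 + a + b + c) := lshift c (lshift b (lshift a 0)).
pose N (u : 'rV[T]_(1 + a + b + c)) := col_mx (col_mx (col_mx u A) B) E.
have N0 u k : N u i0 k = u 0 k by rewrite /N !col_mxEu.
have cofN u w k : cofactor (N u) i0 k = cofactor (N w) i0 k.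
  congr (_ * \det _); apply/matrixP => i j; rewrite !mxE.
  case: splitP => [i1|i1] /= E1; rewrite ?mxE //.
  case: splitP => [i2|i2] /= E2; rewrite ?mxE //.
  case: splitP => [i3|i3] /= E3; rewrite ?mxE //.
  by case/eqP: (neq_lift i0 i); apply/val_inj; rewrite /= E1 E2 E3 ord1.
have detN u : \det (N u) = \sum_k u 0 k * cofactor (N v) i0 k.
  by rewrite (expand_det_row _ i0); apply: eq_bigr => k _; rewrite N0 (cofN u v).
rewrite -!/(N _) detN; apply: eq_bigr => k _; rewrite -/(N _) detN.
rewrite (bigD1 k) //= mxE !eqxx mul1r big1 ?addr0 // => j /negPf neq_jk.
by rewrite mxE neq_jk andbF mul0r.
Qed.

(** [peval] with its arguments exchanged, so that evaluation at a point is
    inferred to be a ring morphism. *)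
Definition ev (R : comNzRingType) n (x : 'rV[R]_n) : mpoly n R -> R :=
  meval (fun i => x 0 i).

HB.instance Definition _ (R : comNzRingType) n (x : 'rV[R]_n) :=
  GRing.RMorphism.on (ev x).

Lemma evC (R : comNzRingType) n (x : 'rV[R]_n) c : ev x (mpolyC n c) = c.
Proof. exact: mevalC. Qed.

(** Cramer's rule. With the square matrix of [basis_through_subspaces], let W.v
    be its determinant after its first row e has been replaced by v. If v is a
    row of A(y), then v and the combinations of rows of A(y) give
    rank A(y0) + 1 rows inside the row space of A(y), so that the determinant
    vanishes unless the rank of A has grown; and likewise for B. At y0 the vector
    e itself gives a nonzero value. The polynomial g is the determinant of the
    original matrix, whose nonvanishing keeps the rank of A from dropping. *)
Lemma annihilating_field (F : fieldType) n m s k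
    (A : 'M[mpoly n F]_(s, m)) (B : 'M[mpoly n F]_(k, m)) (y0 : 'rV[F]_n) :
    (map_mx (ev y0) A <= map_mx (ev y0) B)%MS ->
    (\rank (map_mx (ev y0) B) < m)%N ->
  exists (W : 'rV[mpoly n F]_m) (g : mpoly n F),
    [/\ map_mx (ev y0) W != 0, ev y0 g != 0,
        forall y, ev y g != 0 ->
          (\rank (map_mx (ev y0) A) <= \rank (map_mx (ev y) A))%N,
        forall y, (\rank (map_mx (ev y) A) <= \rank (map_mx (ev y0) A))%N ->
          map_mx (ev y) A *m (map_mx (ev y) W)^T = 0 &
        forall y, (map_mx (ev y) A <= map_mx (ev y) B)%MS ->
          (\rank (map_mx (ev y) B) <= \rank (map_mx (ev y0) B))%N ->
          map_mx (ev y) B *m (map_mx (ev y) W)^T = 0].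
Proof.
move=> sAB ltBm.
have [r2 [r3 [e [P [Q [E]]]]]] := basis_through_subspaces sAB ltBm.
move: (\rank (map_mx (ev y0) A)) P => a P [def_m <-].
case: m / def_m A B e E {sAB ltBm} => A B e E full.
pose cst p q (X : 'M[F]_(p, q)) := map_mx (@mpolyC n F) X.
have evcst y p q (X : 'M[F]_(p, q)) : map_mx (ev y) (cst _ _ X) = X.
  by rewrite -map_mx_comp map_mx_id // => c; rewrite /= evC.
pose N (v : 'rV[mpoly n F]_(1 + a + r2 + r3)) :=
  col_mx (col_mx (col_mx v (cst _ _ P *m A)) (cst _ _ Q *m B)) (cst _ _ E).
have evN y v : map_mx (ev y) (N v) =
    col_mx (col_mx (col_mx (map_mx (ev y) v) (P *m map_mx (ev y) A))
      (Q *m map_mx (ev y) B)) E.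
  by rewrite !map_col_mx !map_mxM !evcst.
pose W : 'rV_(1 + a + r2 + r3) := \row_k \det (N (delta_mx 0 k)).
have evW y (v : 'rV[F]_(1 + a + r2 + r3)) :
    (v *m (map_mx (ev y) W)^T) 0 0 = \det (map_mx (ev y) (N (cst _ _ v))).
  rewrite evN evcst det_first_row_linear mxE; apply: eq_bigr => l _.
  congr (_ * _); rewrite !mxE -det_map_mx evN.
  congr (\det (col_mx (col_mx (col_mx _ _) _) _)).
  by rewrite map_delta_mx.
have evg y : ev y (\det (N (cst _ _ e))) =
    \det (col_mx (col_mx (col_mx e (P *m map_mx (ev y) A)) (Q *m map_mx (ev y) B)) E).
  by rewrite -det_map_mx evN evcst.
have unitN0 : \det (col_mx (col_mx (col_mx e (P *m map_mx (ev y0) A))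
    (Q *m map_mx (ev y0) B)) E) != 0.
  by rewrite -unitfE -unitmxE -row_full_unit.
exists W, (\det (N (cst _ _ e))); split.
- apply: contraNneq unitN0 => W0.
  by rewrite -evg -det_map_mx -evW W0 trmx0 mulmx0 mxE.
- by rewrite evg.
- move=> y; rewrite evg => g0.
  have : row_free (col_mx (col_mx (col_mx e (P *m map_mx (ev y) A))
      (Q *m map_mx (ev y) B)) E) by rewrite row_free_unit unitmxE unitfE.
  case/row_free_col_mx=> /row_free_col_mx[/row_free_col_mx[_ /eqP rkPA] _] _.
  exact: leq_trans (eq_leq (esym rkPA)) (mxrankM_maxr _ _).
- move=> y rkA; apply/row_matrixP => i; rewrite row_mul row0.
  apply/matrixP => i1 i2; rewrite !ord1 evW evN evcst mxE.
  apply: det_col_mx_eq0; rewrite -addsmxE.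
  apply: leq_ltn_trans (mxrank_adds_leqif _ _) _.
  apply: (@leq_add (\rank _).+1 _ (1 + a) r2); last exact: rank_leq_row.
  apply: (@leq_ltn_trans a); last exact: leqnn.
  apply: leq_trans (mxrankS _) rkA; rewrite -addsmxE addsmx_sub.
  by rewrite row_sub submxMl.
- move=> y sABy rkB; apply/row_matrixP => i; rewrite row_mul row0.
  apply/matrixP => i1 i2; rewrite !ord1 evW evN evcst mxE.
  apply: det_col_mx_eq0; apply: (@leq_ltn_trans (a + r2)); last by rewrite -addnA.
  apply: leq_trans (mxrankS _) rkB.
  rewrite -addsmxE addsmx_sub submxMl andbT -addsmxE addsmx_sub row_sub.
  by rewrite (submx_trans _ sABy) // submxMl.
Qed.

(** * Gradients on a variety and dominance of a projection *)

(** Identities between ring morphisms or derivations need only be checked on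
    constants and variables. *)
Lemma mpoly_ring_ind (R : comNzRingType) n (P : mpoly n R -> Prop) :
    (forall c, P (mpolyC n c)) -> (forall i, P (mpolyX R (mnm1 i))) ->
    (forall p q, P p -> P q -> P (p + q)) ->
    (forall p q, P p -> P q -> P (p * q)) ->
  forall p, P p.
Proof.
move=> PC PX PD PM p; have P0 : P 0 by rewrite -(mpolyC0 n R).
elim/mpolyind: p => // c m q _ _ Pq; apply: PD => //.
rewrite -mul_mpolyC; apply: (PM) => //; rewrite mpolyXE_id.
have P1 : P 1 by rewrite -(mpolyC1 n R).
apply: (big_ind P P1 PM) => // i _; elim: (m i) => [|k IHk]; first by rewrite expr0.
by rewrite exprS; apply: (PM).
Qed.

Lemma mderivXU (R : comNzRingType) n (i j : 'I_n) :
  mderiv j (mpolyX R (mnm1 i)) = (i == j)%:R.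
Proof.
rewrite mderivX mnm1E; case: eqP => [->|_]; last by rewrite scale0r.
rewrite scale1r -(mpolyX0 n R); congr (mpolyX R _); apply/mnmP => k.
by rewrite mnmBE subnn mnm0E.
Qed.

Lemma mderiv_comp (R : comNzRingType) n k (t : n.-tuple (mpoly k R))
    (p : mpoly n R) (j : 'I_k) :
  mderiv j (comp_mpoly t p) =
  \sum_i comp_mpoly t (mderiv i p) * mderiv j (tnth t i).
Proof.
elim/mpoly_ring_ind: p => [c|l|p q IHp IHq|p q IHp IHq].
- by rewrite comp_mpolyC mderivC big1 // => i _; rewrite mderivC raddf0 mul0r.
- rewrite comp_mpolyXU -tnth_nth (bigD1 l) //= big1 => [|i neq_il].
    by rewrite addr0 mderivXU eqxx comp_mpoly1 mul1r.
  by rewrite mderivXU eq_sym (negPf neq_il) raddf0 mul0r.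
- rewrite raddfD /= mderivD IHp IHq -big_split; apply: eq_bigr => i _.
  by rewrite mderivD raddfD mulrDl.
- rewrite rmorphM /= mderivM IHp IHq mulr_suml mulr_sumr -big_split /=.
  apply: eq_bigr => i _; rewrite mderivM raddfD /= !rmorphM /=; ring.
Qed.

Definition pullback_fst (R : comNzRingType) n k (p : mpoly n R) :
    mpoly (n + k) R :=
  comp_mpoly [tuple mpolyX R (mnm1 (lshift k i)) | i < n] p.

Lemma ev_pullback_fst (R : comNzRingType) n k (p : mpoly n R)
    (w : 'rV[R]_(n + k)) : ev w (pullback_fst k p) = ev (lsubmx w) p.
Proof.
rewrite /ev /pullback_fst comp_mpoly_meval; apply: meval_eq => i.
by rewrite tnth_mktuple mevalXU mxE.
Qed.

Definition grad (R : comNzRingType) n (p : mpoly n R) : 'rV[mpoly n R]_n :=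
  \row_j mderiv j p.

Lemma ev_grad_pullback_fst (R : comNzRingType) n k (p : mpoly n R)
    (w : 'rV[R]_(n + k)) :
  map_mx (ev w) (grad (pullback_fst k p)) =
  map_mx (ev (lsubmx w)) (grad p) *m row_mx 1%:M 0.
Proof.
rewrite mul_mx_row mulmx1 mulmx0; apply/rowP => j.
rewrite !mxE mderiv_comp rmorph_sum /=.
case: splitP => [l|l] def_j; rewrite !mxE.
  have -> : j = lshift k l by apply/val_inj.
  rewrite (bigD1 l) //= big1 => [|i neq_il].
    rewrite addr0 rmorphM /= ev_pullback_fst tnth_mktuple mderivXU eqxx.
    by rewrite rmorph1 mulr1.
  by rewrite tnth_mktuple mderivXU (inj_eq (@lshift_inj _ _)) (negPf neq_il)
    mulr0 rmorph0.
apply: big1 => i _; rewrite tnth_mktuple mderivXU -val_eqE /= def_j.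
by rewrite ltn_eqF ?ltn_addr // mulr0 rmorph0.
Qed.

Section VarietyGradients.
Variables (F : fieldType) (n : nat) (V : irr_variety F n).

Definition grad_gens : 'M[mpoly n F]_(size (gens V), n) :=
  \matrix_(i, j) mderiv j (gens V)`_i.

Lemma ev_grad_gens y : map_mx (ev y) grad_gens = (Defs.jacobian V y)^T.
Proof. by apply/matrixP => i j; rewrite !mxE. Qed.

Lemma rank_grad_gens y :
  \rank (map_mx (ev y) grad_gens) = \rank (Defs.jacobian V y).
Proof. by rewrite ev_grad_gens mxrank_tr. Qed.

Lemma gens_vanish y (q : mpoly n F) :
  points V y -> q \in gens V -> ev y q = 0.
Proof.
move=> Vy q_gen; suff : vanishing_ideal V q by exact.
have lt_i : (index q (gens V) < size (gens V))%N by rewrite index_mem.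
rewrite gensP; exists (fun j => (Ordinal lt_i == j)%:R).
rewrite (bigD1 (Ordinal lt_i)) //= eqxx mul1r nth_index // big1 ?addr0 //.
by move=> j /negPf neq_ji; rewrite eq_sym neq_ji mul0r.
Qed.

(** On V, differentiating f = \sum_i q_i g_i leaves only the terms
    q_i dg_i. *)
Lemma grad_vanishing y (f : mpoly n F) :
    points V y -> (forall x, points V x -> ev x f = 0) ->
  (map_mx (ev y) (grad f) <= map_mx (ev y) grad_gens)%MS.
Proof.
move=> Vy f0; have : vanishing_ideal V f by [].
rewrite gensP => -[q def_f]; apply/submxP; exists (\row_i ev y (q i)).
have g0 (i : 'I_(size (gens V))) : ev y (gens V)`_i = 0.
  exact: gens_vanish (mem_nth _ _).
apply/rowP => j; rewrite !mxE def_f (raddf_sum (mderiv j)) rmorph_sum.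
apply: eq_bigr => i _ /=.
by rewrite !mxE mderivM rmorphD !rmorphM /= g0 mulr0 add0r.
Qed.

Lemma rank_jacobian_le_generic y :
  points V y -> (\rank (Defs.jacobian V y) <= generic_rank V)%N.
Proof.
move=> Vy; have ltr : (\rank (Defs.jacobian V y) < n.+1)%N.
  by rewrite ltnS rank_leq_row.
apply: (@bigop.leq_bigmax_cond _ _ (fun r : 'I_n.+1 => nat_of_ord r)
  (Ordinal ltr)).
by apply/asboolP; exists y.
Qed.

End VarietyGradients.

Lemma msize_mderiv (R : nzRingType) n (i : 'I_n) (p : mpoly n R) :
  (mmeasure mdeg (mderiv i p) <= (mmeasure mdeg p).-1)%N.
Proof.
rewrite [X in (X <= _)%N]mmeasureE; apply/bigmax_leqP_seq => m.
rewrite mcoeff_msupp mcoeff_deriv => nz _.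
have : mnm_add m (mnm1 i) \in msupp p.
  by rewrite mcoeff_msupp; apply: contraNneq nz => ->; rewrite mul0rn.
by move/msize_mdeg_lt; rewrite mdegD mdeg1 addn1; case: (mmeasure _ _).
Qed.

Lemma mderiv_eq0_const (R : numDomainType) n (p : mpoly n R) :
  (forall i, mderiv i p = 0) -> p = mpolyC n (mcoeff mnm0 p).
Proof.
move=> dp0; apply/mpolyP => m; rewrite mcoeffC.
have [->|m_neq0] := eqVneq m mnm0; first by rewrite mulr1.
rewrite mulr0.
have [i mi_neq0] : exists i, m i != 0%N.
  apply/existsP; apply: contraNT m_neq0 => /existsPn m0; apply/eqP/mnmP => i.
  by rewrite mnm0E; apply/eqP; rewrite -[_ == _]negbK.
have := mcoeff_deriv i (mnm_sub m (mnm1 i)) p; rewrite dp0 mcoeff0 submK.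
  by move/esym/eqP; rewrite mulrn_eq0 /= => /eqP.
by rewrite lep1mP.
Qed.

(** The rank bounds force the row spaces of J and D to be in direct sum. *)
Lemma submx_both_eq0 (F : fieldType) s n k m p (J : 'M[F]_(s, m))
    (D : 'M[F]_(n, m)) (v : 'M[F]_(p, m)) :
    (\rank J <= k)%N -> \rank (col_mx J D) = (n + k)%N ->
  (v <= J)%MS -> (v <= D)%MS -> v = 0.
Proof.
move=> leJk rkJD vJ vD; apply/eqP; rewrite -submx0.
suff <- : (J :&: D)%MS = 0 by rewrite sub_capmx vJ.
apply/eqP; rewrite -mxrank_eq0; have := mxrank_sum_cap J D.
by rewrite addsmxE rkJD; have := rank_leq_row D; lia.
Qed.

Section Dominance.
Variables (F : numFieldType) (n k : nat) (V : irr_variety F (n + k)).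

(** The tangent map of the projection V -> F^n at y is onto, for a smooth point
    y of V, exactly when dx_1, ..., dx_n are independent modulo the gradients of
    the ideal of V. With k the rank of these gradients, this says that the
    present matrix has full rank at y. *)
Definition grad_proj : 'M[mpoly (n + k) F]_(size (gens V) + n, n + k) :=
  col_mx (grad_gens V) (map_mx (@mpolyC _ F) (row_mx 1%:M 0)).

Lemma ev_grad_proj y : map_mx (ev y) grad_proj =
  col_mx (map_mx (ev y) (grad_gens V)) (row_mx 1%:M 0).
Proof.
rewrite map_col_mx; congr col_mx; rewrite -map_mx_comp map_mx_id // => c.
by rewrite /= evC.
Qed.

Lemma grad_vanishing_on_fst (f : mpoly n F) y :
    (generic_rank V <= k)%N -> points V y ->
    \rank (map_mx (ev y) grad_proj) = (n + k)%N ->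
    (forall w, points V w -> ev (lsubmx w) f = 0) ->
  map_mx (ev (lsubmx y)) (grad f) = 0.
Proof.
move=> rkV Vy rky f0.
suff : map_mx (ev (lsubmx y)) (grad f) *m row_mx 1%:M (0 : 'M[F]_(n, k)) = 0.
  rewrite mul_mx_row mulmx1 mulmx0 => /(congr1 lsubmx).
  by rewrite row_mxKl => ->; apply/matrixP => i j; rewrite !mxE.
apply: (@submx_both_eq0 _ _ n k _ _ (map_mx (ev y) (grad_gens V))
  (row_mx 1%:M 0)).
- by rewrite rank_grad_gens (leq_trans _ rkV) // rank_jacobian_le_generic.
- by rewrite -ev_grad_proj.
- rewrite -ev_grad_pullback_fst; apply: grad_vanishing => // x Vx.
  by rewrite ev_pullback_fst f0.
- exact: submxMl.
Qed.

(** Full rank at a single point y0 propagates to the nonvanishing locus of a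
    polynomial g, a combination of the maximal minors with g(y0) = 1. Since V is
    the union of its traces on the zero loci of g and of each partial derivative
    of f, irreducibility puts V inside the latter, and the induction on the
    degree applies. *)
Lemma fst_dense_of_rank (y0 : 'rV[F]_(n + k)) :
    (generic_rank V <= k)%N -> points V y0 ->
    \rank (map_mx (ev y0) grad_proj) = (n + k)%N ->
  forall f : mpoly n F, (forall w, points V w -> ev (lsubmx w) f = 0) -> f = 0.
Proof.
move=> rkV Vy0 rky0.
have [P defP] : exists P, 1%:M = P *m map_mx (ev y0) grad_proj.
  by apply/submxP; rewrite sub1mx /row_full rky0.
pose g := \det (map_mx (@mpolyC _ F) P *m grad_proj).
have evg y : ev y g = \det (P *m map_mx (ev y) grad_proj).
  rewrite -det_map_mx map_mxM -map_mx_comp; congr (\det (_ *m _)).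
  by rewrite map_mx_id // => c; rewrite /= evC.
have rkg y : ev y g != 0 -> \rank (map_mx (ev y) grad_proj) = (n + k)%N.
  rewrite evg -unitfE -unitmxE -row_free_unit => /eqP rkP; apply/eqP.
  by rewrite eqn_leq rank_leq_col -{1}rkP mxrankM_maxr.
move=> f; have [d] := ubnP (mmeasure mdeg f); elim: d f => // d IHd f ltfd f0.
have df0 i : mderiv i f = 0.
  have [->|nz_f] := eqVneq f 0; first by rewrite mderiv0.
  apply: IHd => [|w Vw].
    rewrite (leq_ltn_trans (msize_mderiv _ _)) //.
    by move: ltfd; rewrite mpolySpred.
  pose A := zero_locus [:: pullback_fst k (mderiv i f)].
  pose B := zero_locus [:: g].
  have [_ irrV] := points_irreducible V.
  have [] := irrV A B.
  - by exists [:: pullback_fst k (mderiv i f)].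
  - by exists [:: g].
  - move=> y Vy; have [g0|/rkg rky] := eqVneq (ev y g) 0.
      by right=> p; rewrite inE => /eqP->.
    left=> p; rewrite inE => /eqP->.
    have := grad_vanishing_on_fst rkV Vy rky f0.
    move/rowP/(_ i); rewrite !mxE => df.
    by rewrite -[LHS]/(ev y _) ev_pullback_fst.
  - move=> /(_ w Vw (pullback_fst k (mderiv i f))); rewrite inE eqxx => /(_ isT).
    by rewrite -[X in X -> _]/(ev w _ = 0) ev_pullback_fst.
  - move=> /(_ y0 Vy0 g); rewrite inE eqxx => /(_ isT).
    rewrite -[X in X -> _]/(ev y0 g = 0) evg -defP det1 => /eqP.
    by rewrite oner_eq0.
rewrite (mderiv_eq0_const df0) in f0 *.
by have := f0 _ Vy0; rewrite evC => ->; rewrite mpolyC0.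
Qed.

End Dominance.

(** * A weighted coefficient norm on polynomials *)

Section WeightedNorm.
Variables (R : realFieldType) (n : nat) (B : R).
Hypothesis B_ge1 : 1 <= B.
Implicit Types p q : mpoly n R.

Let B_ge0 : 0 <= B. Proof. exact: le_trans ler01 B_ge1. Qed.

(** The weights B ^+ deg make the norm submultiplicative and, when B bounds the
    coordinates of x, an upper bound for the evaluation at x. *)
Definition wnorm p := \sum_(m <- msupp p) `|mcoeff m p| * B ^+ mdeg m.

Lemma wnormE k p : (mmeasure mdeg p <= k)%N ->
  wnorm p = \sum_(m : bmultinom n k) `|mcoeff m p| * B ^+ mdeg m.
Proof.
move=> lepk; rewrite /wnorm (big_mksub (bmultinom n k)) /=; first last.
- by move=> m /msize_mdeg_lt/leq_trans; apply.
- exact: msupp_uniq.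
rewrite big_rmcond //= => m /memN_msupp_eq0 ->.
by rewrite normr0 mul0r.
Qed.

Lemma wnorm_ge0 p : 0 <= wnorm p.
Proof. by apply: sumr_ge0 => m _; rewrite mulr_ge0 ?exprn_ge0. Qed.

Lemma wnorm0 : wnorm 0 = 0.
Proof. by rewrite /wnorm msupp0 big_nil. Qed.

Lemma wnormX m : wnorm (mpolyX R m) = B ^+ mdeg m.
Proof. by rewrite /wnorm msuppX big_seq1 mcoeffX eqxx normr1 mul1r. Qed.

Lemma wnormZ c p : wnorm (c *: p) = `|c| * wnorm p.
Proof.
rewrite (@wnormE (mmeasure mdeg p)) ?mmeasureZ_le // (wnormE (leqnn _)).
by rewrite mulr_sumr; apply: eq_bigr => m _; rewrite mcoeffZ normrM mulrA.
Qed.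

Lemma wnormD p q : wnorm (p + q) <= wnorm p + wnorm q.
Proof.
pose k := maxn (mmeasure mdeg p) (mmeasure mdeg q).
rewrite !(@wnormE k) ?leq_maxl ?leq_maxr //; last exact: mmeasureD_le.
rewrite -big_split /=; apply: ler_sum => m _.
by rewrite -mulrDl ler_wpM2r ?exprn_ge0 // mcoeffD ler_normD.
Qed.

Lemma wnorm_sum (I : Type) (r : seq I) (P : pred I) (f : I -> mpoly n R) :
  wnorm (\sum_(i <- r | P i) f i) <= \sum_(i <- r | P i) wnorm (f i).
Proof.
elim/big_rec2: _ => [|i y1 y2 _ le12]; first by rewrite wnorm0.
by rewrite (le_trans (wnormD _ _)) // lerD2l.
Qed.

Lemma wnormM p q : wnorm (p * q) <= wnorm p * wnorm q.
Proof.
rewrite mpolyME (le_trans (wnorm_sum _ _ _)) // big_allpairs /= mulr_suml.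
apply: ler_sum => m1 _; rewrite mulr_sumr; apply: ler_sum => m2 _.
by rewrite wnormZ wnormX mdegD exprD normrM mulrACA.
Qed.

Lemma wnorm_mderiv i p :
  wnorm (mderiv i p) <= (mmeasure mdeg p)%:R * wnorm p.
Proof.
rewrite /mderiv (le_trans (wnorm_sum _ _ _)) // mulr_sumr.
rewrite [X in X <= _]big_seq [X in _ <= X]big_seq.
apply: ler_sum => m supp_m.
rewrite wnormZ wnormX normrM normr_nat -mulrA.
apply: ler_pM; rewrite ?mulr_ge0 ?exprn_ge0 //.
  rewrite ler_nat (leq_trans _ (ltnW (msize_mdeg_lt supp_m))) //.
  by rewrite mdegE (bigD1 i) //= leq_addr.
by rewrite ler_wpM2l // ler_weXn2l // mdegB.
Qed.

Lemma norm_ev_le_wnorm (x : 'rV[R]_n) p :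
  (forall i, `|x 0 i| <= B) -> `|ev x p| <= wnorm p.
Proof.
move=> xB; rewrite /ev mevalE (le_trans (ler_norm_sum _ _ _)) //.
apply: ler_sum => m _; rewrite normrM ler_wpM2l // normr_prod mdegE.
rewrite -prodrXr; apply: ler_prod => i _; rewrite normr_ge0 normrX /=.
by rewrite lerXn2r ?nnegrE.
Qed.

End WeightedNorm.

Lemma mmeasureM_le (R : nzRingType) n (p q : mpoly n R) :
  (mmeasure mdeg (p * q) <= mmeasure mdeg p + mmeasure mdeg q)%N.
Proof.
rewrite [X in (X <= _)%N]mmeasureE; apply/bigmax_leqP_seq => m supp_m _.
have /allpairsP[[m1 m2] /= [supp1 supp2 ->]] := msuppM_le supp_m.
rewrite mdegD; have := msize_mdeg_lt supp1; have := msize_mdeg_lt supp2.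
by lia.
Qed.

(** * Cauchy products *)

(** The partial sums of the product series differ from the product of the
    partial sums by coefficients of degree at least N of a product of two
    polynomials of size N, and these are bounded by
    (k + 1) A B 4^-k <= A B 2^-k. *)
Lemma cvg_cauchy_product (R : realType) (a b : R^nat) (A B : R) :
    (forall k, `|a k| <= A * 4^-1 ^+ k) -> (forall k, `|b k| <= B * 4^-1 ^+ k) ->
    cvgn (series a) -> cvgn (series b) ->
  series (fun k => \sum_(i < k.+1) a i * b (k - i)%N) @ \oo -->
    limn (series a) * limn (series b).
Proof.
move=> leA leB cva cvb; set c := fun k => _.
have A_ge0 : 0 <= A by rewrite -[A]mulr1 (le_trans _ (leA 0)).
have B_ge0 : 0 <= B by rewrite -[B]mulr1 (le_trans _ (leB 0)).
have defc : series c = (series a \* series b) - (series a \* series b - series c).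
  by rewrite opprB addrC subrK.
rewrite defc -[X in _ --> X]subr0; apply: cvgB; first exact: cvgM.
have geo0 : geometric (2 * (A * B)) 2^-1 @ \oo --> (0 : R).
  by apply: cvg_geometric; rewrite ger0_norm ?invr_ge0 // invf_lt1 // ltr1n.
apply: (@squeeze_cvgr _ _ _ _ (fun N => - geometric (2 * (A * B)) 2^-1 N)
  (geometric (2 * (A * B)) 2^-1)); [|by rewrite -oppr0; apply: cvgN|exact: geo0].
apply: nearW => N; rewrite -ler_norml /=.
(* Evaluating the truncations as polynomials at 1 turns the product of the
   partial sums into a sum of coefficients. *)
pose P := \poly_(i < N) a i; pose Q := \poly_(i < N) b i.
have PQle k : `|(P * Q)`_k| <= A * B * 2^-1 ^+ k.
  have leP i : `|P`_i| <= A * 4^-1 ^+ i.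
    by rewrite coef_poly; case: ifP; rewrite // normr0 mulr_ge0 ?exprn_ge0.
  have leQ i : `|Q`_i| <= B * 4^-1 ^+ i.
    by rewrite coef_poly; case: ifP; rewrite // normr0 mulr_ge0 ?exprn_ge0.
  rewrite coefM (le_trans (ler_norm_sum _ _ _)) //.
  apply: (@le_trans _ _ (\sum_(i < k.+1) A * B * 4^-1 ^+ k)).
    apply: ler_sum => i _; rewrite normrM.
    apply: le_trans (ler_pM _ _ (leP i) (leQ _)) _ => //.
    by rewrite mulrACA -exprD subnKC // -ltnS.
  rewrite sumr_const card_ord -(mulr_natr _ k.+1) -mulrA ler_wpM2l ?mulr_ge0 //.
  have -> : 4^-1 = 2^-1 * 2^-1 :> R by rewrite -invfM -natrM.
  rewrite exprMn -mulrA ger_pMr ?exprn_gt0 ?invr_gt0 //.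
  by rewrite exprVn ler_pdivrMl ?exprn_gt0 // mulr1 -natrX ler_nat ltn_expl.
have defab : series a N * series b N = \sum_(0 <= k < N + N) (P * Q)`_k.
  have leP : (size P <= N)%N by exact: size_poly.
  have leQ : (size Q <= N)%N by exact: size_poly.
  rewrite big_mkord -[LHS]/(_ * _) /series /= !big_mkord.
  have sizePQ : (size (P * Q)%R <= N + N)%N.
    by rewrite (leq_trans (size_polyMleq _ _)) // (leq_trans (leq_pred _)) // leq_add.
  transitivity ((P * Q).[1]).
    rewrite hornerM (horner_coef_wide _ leP) (horner_coef_wide _ leQ).
    by congr (_ * _); apply: eq_bigr => i _; rewrite expr1n mulr1 coef_poly ltn_ord.
  rewrite (horner_coef_wide _ sizePQ); apply: eq_bigr => i _.
  by rewrite expr1n mulr1.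
have defcN : series c N = \sum_(0 <= k < N) (P * Q)`_k.
  apply: eq_big_nat => k /andP[_ ltkN]; rewrite coefM; apply: eq_bigr => i _.
  rewrite !coef_poly !ifT //; first by rewrite (leq_ltn_trans (leq_subr _ _)).
  by rewrite (leq_trans (ltn_ord i)).
have -> : (series a \* series b - series c) N = \sum_(N <= k < N + N) (P * Q)`_k.
  rewrite -[LHS]/(series a N * series b N - series c N) defab defcN.
  by rewrite (big_cat_nat (n := N)) ?leq_addr //= addrAC subrr add0r.
rewrite (le_trans (ler_norm_sum _ _ _)) //.
apply: le_trans (ler_sum _ (fun k _ => PQle k)) _.
rewrite -mulr_sumr geometric_partial_tail geometric_seriesE; last first.
  by rewrite lt_eqF // invf_lt1 // ltr1n.
rewrite /= [2 * _]mulrC -!mulrA !ler_wpM2l //.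
rewrite [2 * _]mulrC ler_wpM2l ?exprn_ge0 ?invr_ge0 //.
have -> : 1 - 2^-1 = 2^-1 :> R by lra.
rewrite invrK ger_pMl // lerBlDr lerDl exprn_ge0 ?invr_ge0 //.
Qed.

(** * Iterated Lie derivatives of polynomials *)

Section LieDerivative.
Variables (R : realType) (n : nat) (W : 'rV[mpoly n R]_n) (y0 : 'rV[R]_n).
Implicit Types f g : mpoly n R.

Definition lie g : mpoly n R := \sum_j W 0 j * mderiv j g.

Lemma lie_is_linear : linear lie.
Proof.
move=> c f g; rewrite /lie scaler_sumr -big_split; apply: eq_bigr => j _ /=.
by rewrite mderivD mderivZ mulrDr scalerAr.
Qed.

HB.instance Definition _ :=
  GRing.isLinear.Build R (mpoly n R) (mpoly n R) _ lie lie_is_linear.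

Lemma lieM f g : lie (f * g) = lie f * g + f * lie g.
Proof.
rewrite /lie mulr_suml mulr_sumr -big_split; apply: eq_bigr => j _ /=.
by rewrite mderivM; ring.
Qed.

Lemma lieC c : lie (mpolyC n c) = 0.
Proof. by rewrite /lie big1 // => j _; rewrite mderivC mulr0. Qed.

Lemma lieX j : lie (mpolyX R (mnm1 j)) = W 0 j.
Proof.
rewrite /lie (bigD1 j) //= big1 => [|i /negPf neq_ij].
  by rewrite addr0 mderivXU eqxx mulr1.
by rewrite mderivXU eq_sym neq_ij mulr0.
Qed.

Lemma ev_lie y g :
  ev y (lie g) = (map_mx (ev y) (grad g) *m (map_mx (ev y) W)^T) 0 0.
Proof.
rewrite !mxE rmorph_sum; apply: eq_bigr => j _.
by rewrite rmorphM !mxE mulrC.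
Qed.

(** The Taylor coefficients at time 0 of g along the flow of W from y0. *)
Definition lie_coef g : R^nat := fun k => ev y0 (iter k lie g) / k`!%:R.

Lemma lie_coef_diffs g : pseries_diffs (lie_coef g) = lie_coef (lie g).
Proof.
apply/funext => k; rewrite /pseries_diffs /lie_coef iterSr factS natrM invfM.
by rewrite mulrCA mulVKf // pnatr_eq0.
Qed.

Lemma lie_coefS g k : k.+1%:R * lie_coef g k.+1 = lie_coef (lie g) k.
Proof. by rewrite -lie_coef_diffs. Qed.

Lemma lie_coef_linear c f g k :
  lie_coef (c *: f + g) k = c * lie_coef f k + lie_coef g k.
Proof.
rewrite /lie_coef.
have -> : iter k lie (c *: f + g) = c *: iter k lie f + iter k lie g.
  by elim: k => //= k ->; rewrite linearP.
by rewrite rmorphD /= {1}/ev mevalZ mulrDl mulrA.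
Qed.

Lemma lie_coefD f g k : lie_coef (f + g) k = lie_coef f k + lie_coef g k.
Proof. by have := lie_coef_linear 1 f g k; rewrite scale1r mul1r. Qed.

(** The Leibniz rule for iterated derivations, divided by factorials. *)
Lemma lie_coefM f g k :
  lie_coef (f * g) k = \sum_(i < k.+1) lie_coef f i * lie_coef g (k - i)%N.
Proof.
elim: k f g => [|k IHk] f g.
  by rewrite big_ord1 /lie_coef /= rmorphM /= fact0 !divr1.
have : k.+1%:R != 0 :> R by rewrite pnatr_eq0.
move/mulfI; apply; rewrite lie_coefS lieM lie_coefD !IHk mulr_sumr.
pose a := lie_coef f; pose b := lie_coef g.
rewrite (eq_bigr (fun i : 'I_k.+2 => i%:R * a i * b (k.+1 - i)%N +
    a i * ((k.+1 - i)%:R * b (k.+1 - i)%N))); last first.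
  move=> i _; have -> : k.+1%:R = i%:R + (k.+1 - i)%:R :> R.
    by rewrite -natrD subnKC // -ltnS.
  by rewrite -/(a i) -/(b _); ring.
rewrite big_split /=; congr (_ + _).
  rewrite [RHS]big_ord_recl /= !mul0r add0r; apply: eq_bigr => i _.
  by rewrite -lie_coefS /a /bump /= add1n subSS.
rewrite [RHS]big_ord_recr /= subnn mul0r mulr0 addr0; apply: eq_bigr => i _.
by rewrite subSn -1?ltnS // -lie_coefS.
Qed.

Lemma msize_lie e g : (forall j, (mmeasure mdeg (W 0%R j) <= e)%N) ->
  (mmeasure mdeg (lie g) <= e + mmeasure mdeg g)%N.
Proof.
move=> leWe; rewrite (leq_trans (mmeasure_sum _ _ _ _)) //.
apply/bigmax_leqP => j _; rewrite (leq_trans (mmeasureM_le _ _)) // leq_add //.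
by rewrite (leq_trans (msize_mderiv _ _)) // leq_pred.
Qed.

Lemma wnorm_lie B g : 1 <= B ->
  wnorm B (lie g) <=
  (\sum_j wnorm B (W 0 j)) * ((mmeasure mdeg g)%:R * wnorm B g).
Proof.
move=> B1; rewrite (le_trans (wnorm_sum B1 _ _ _)) // mulr_suml.
apply: ler_sum => j _; rewrite (le_trans (wnormM B1 _ _)) //.
by rewrite ler_wpM2l ?wnorm_ge0 ?wnorm_mderiv.
Qed.

Lemma bin_le_exp2 m k : ('C(m, k) <= 2 ^ m)%N.
Proof.
elim: m k => [|m IHm] [|k] //; first by rewrite bin0 expn_gt0.
by rewrite binS expnS mul2n -addnn leq_add.
Qed.

(** Each application of W adds at most e to the degree and multiplies the norm
    by at most w times the degree. Hence after k steps the norm has grown by at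
    most (w e)^k (d + 1) ... (d + k) = (w e)^k k! 'C(d + k, k), and k! cancels.
    The binomial is at most 2^d 2^k, so the rate q does not depend on g and one
    radius of convergence serves all polynomials. *)
Lemma lie_coef_bound :
  exists2 q : R, 0 < q &
    forall g, exists A, forall k, `|lie_coef g k| <= A * q ^+ k.
Proof.
pose B : R := 1 + \sum_j `|y0 0 j|.
have B1 : 1 <= B by rewrite lerDl sumr_ge0.
have y0B i : `|y0 0 i| <= B.
  by rewrite /B (bigD1 i) //= [X in _ <= X]addrCA lerDl addr_ge0 ?sumr_ge0.
pose e := (\max_j mmeasure mdeg (W 0%R j)).+1.
have leWe j : (mmeasure mdeg (W 0%R j) <= e)%N.
  by apply: leqW; apply: (@leq_bigmax _ (fun j => mmeasure mdeg (W 0%R j))).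
pose w := \sum_j wnorm B (W 0 j).
have w0 : 0 <= w by apply: sumr_ge0 => j _; apply: wnorm_ge0.
pose u := w * e%:R; have u0 : 0 <= u by rewrite mulr_ge0.
exists (2 * u + 1) => [|g]; first by rewrite ltr_wpDl ?mulr_ge0.
pose d := mmeasure mdeg g.
have size_iter k : (mmeasure mdeg (iter k lie g) <= k * e + d)%N.
  elim: k => //= k IHk; rewrite (leq_trans (msize_lie _ leWe)) //.
  by rewrite mulSn -addnA leq_add2l.
have norm_iter k :
    wnorm B (iter k lie g) <= u ^+ k * ((d + k) ^_ k)%:R * wnorm B g.
  elim: k => [|k IHk]; first by rewrite expr0 ffactn0 !mul1r.
  rewrite iterS (le_trans (wnorm_lie _ B1)) // -/w.
  apply: (@le_trans _ _ (w * ((e * (d + k).+1)%:R *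
      (u ^+ k * ((d + k) ^_ k)%:R * wnorm B g)))).
    rewrite ler_wpM2l // ler_pM ?wnorm_ge0 // ler_nat (leq_trans (size_iter k)) //.
    rewrite mulnC addnC mulnS mulnDr (leq_trans _ (leq_addl _ _)) //.
    by rewrite leq_add2r leq_pmull.
  rewrite addnS ffactSS exprS !natrM; move: (u ^+ k) => uk; rewrite /u.
  rewrite le_eqVlt; apply/orP; left; apply/eqP.
  move: e%:R ((d + k).+1)%:R ((d + k) ^_ k)%:R (wnorm B g).
  by move=> *; ring.
exists (2 ^+ d * wnorm B g) => k.
rewrite /lie_coef normrM normfV normr_nat ler_pdivrMr ?ltr0n ?fact_gt0 //.
apply: le_trans (norm_ev_le_wnorm B1 _ y0B) _.
apply: le_trans (norm_iter k) _.
apply: (@le_trans _ _ (u ^+ k * (2 ^+ (d + k) * k`!%:R) * wnorm B g)).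
  rewrite ler_wpM2r ?wnorm_ge0 // ler_wpM2l ?exprn_ge0 //.
  by rewrite -bin_ffact -natrX -natrM ler_nat leq_mul2r bin_le_exp2 orbT.
rewrite exprD; have -> : u ^+ k * (2 ^+ d * 2 ^+ k * k`!%:R) * wnorm B g =
    2 ^+ d * wnorm B g * (2 * u) ^+ k * k`!%:R.
  rewrite (exprMn k 2 u); move: (u ^+ k) (2 ^+ d) (2 ^+ k) k`!%:R (wnorm B g).
  by move=> *; ring.
rewrite ler_wpM2r // ler_wpM2l ?mulr_ge0 ?exprn_ge0 ?wnorm_ge0 //.
by rewrite lerXn2r ?nnegrE ?addr_ge0 ?mulr_ge0 // lerDl.
Qed.
End LieDerivative.

(** * The flow of a polynomial vector field *)

(** The point y(t) has the Lie series of the variables as coordinates; since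
    g |-> F_g(t) is a ring morphism, F_g(t) is then the value of every g at y(t).
    The third property follows as all the terms of the series are 0, and the
    fourth is term-by-term differentiation. *)
Lemma polynomial_flow (R : realType) n (W : 'rV[mpoly n R]_n) (y0 : 'rV[R]_n) :
  exists (r : R) (y : R -> 'rV[R]_n),
    [/\ 0 < r, y 0 = y0,
        forall g, (forall k, ev y0 (iter k (lie W) g) = 0) ->
          forall t, `|t| < r -> ev (y t) g = 0 &
        forall g t, `|t| < r ->
          is_derive t (1 : R) (fun s : R => ev (y s) g : R) (ev (y t) (lie W g))].
Proof.
have [q q0 bound] := lie_coef_bound W y0.
(* This radius makes the terms of every Lie series O(4^-k), as the Cauchy
   product requires. *)
pose r : R := (4 * q)^-1.
have r0 : 0 < r by rewrite invr_gt0 mulr_gt0.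
have term_bound g : exists A, forall t, `|t| <= r ->
    forall k, `|lie_coef W y0 g k * t ^+ k| <= A * 4^-1 ^+ k.
  have [A leA] := bound g; exists A => t ltr k.
  have A0 : 0 <= A by have := leA 0; rewrite expr0 mulr1; exact: le_trans.
  rewrite normrM (le_trans (ler_wpM2r _ (leA k))) // -mulrA ler_wpM2l //.
  rewrite normrX -exprMn lerXn2r ?nnegrE ?mulr_ge0 ?(ltW q0) ?invr_ge0 //.
  by rewrite -ler_pdivlMl // -invfM mulrC.
have cvg_coef g t : `|t| <= r -> cvgn (pseries (lie_coef W y0 g) t).
  move=> ltr; have [A leA] := term_bound g.
  have A0 : 0 <= A by have := leA t ltr 0; rewrite !expr0 !mulr1; exact: le_trans.
  apply: normed_cvg; apply: series_le_cvg (leA t ltr) _ => //.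
    by move=> k; rewrite mulr_ge0 ?exprn_ge0.
  apply: is_cvg_geometric_series.
  by rewrite ger0_norm ?invr_ge0 // invf_lt1 // ltr1n.
pose Phi g t := limn (pseries (lie_coef W y0 g) t).
have PhiM f g t : `|t| <= r -> Phi (f * g) t = Phi f t * Phi g t.
  move=> ltr; have [A leA] := term_bound f; have [B leB] := term_bound g.
  have := cvg_cauchy_product (leA t ltr) (leB t ltr)
    (cvg_coef f t ltr) (cvg_coef g t ltr).
  move=> /cvg_lim <- //; congr (limn (series _)); apply/funext => k /=.
  rewrite lie_coefM mulr_suml; apply: eq_bigr => i _.
  by rewrite [RHS]mulrACA -exprD subnKC // -ltnS.
have PhiD f g t : `|t| <= r -> Phi (f + g) t = Phi f t + Phi g t.
  move=> ltr; rewrite -[RHS]lim_seriesD; try exact: cvg_coef.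
  congr (limn (series _)); apply/funext => k /=.
  by rewrite lie_coefD mulrDl.
have Phi_const g c t :
    (forall k, lie_coef W y0 g k = c *+ (k == 0)%N) -> Phi g t = c.
  move=> gE; apply: cvg_lim => //; apply: cvg_near_cst.
  exists 1%N => // -[|k] //= _; rewrite /pseries /series /= big_mkord.
  rewrite big_ord_recl /= gE mulr1 big1 ?addr0 // => i _.
  by rewrite gE mul0r.
have PhiC c t : Phi (mpolyC n c) t = c.
  apply: Phi_const => -[|k]; first by rewrite /lie_coef /= evC fact0 divr1.
  rewrite /lie_coef iterSr lieC.
  suff -> : iter k (lie W) 0 = 0 by rewrite rmorph0 mul0r.
  by elim: k => //= k ->; rewrite raddf0.
pose y t := \row_j Phi (mpolyX R (mnm1 j)) t.
have evy g t : `|t| <= r -> ev (y t) g = Phi g t.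
  move=> ltr; elim/mpoly_ring_ind: g => [c|j|f g IHf IHg|f g IHf IHg].
  - by rewrite evC PhiC.
  - by rewrite /ev mevalXU mxE.
  - by rewrite rmorphD /= IHf IHg PhiD.
  - by rewrite rmorphM /= IHf IHg PhiM.
exists r, y; split=> //.
- apply/rowP => j; rewrite mxE; apply: cvg_lim => //; apply: cvg_near_cst.
  exists 1%N => // -[|k] //= _; rewrite /pseries /series /= big_mkord.
  rewrite big_ord_recl /= big1 ?addr0 => [|i _]; last by rewrite exprS mul0r mulr0.
  by rewrite expr0 mulr1 /lie_coef /= fact0 divr1 /ev mevalXU.
- move=> g g0 t ltr; rewrite evy ?ltW // (Phi_const _ 0) // => k.
  by rewrite /lie_coef g0 mul0r mul0rn.
- move=> g t ltr; rewrite evy ?ltW //.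
  have dPhi : is_derive t (1 : R) (Phi g : R -> R) (Phi (lie W g) t).
    rewrite /Phi -lie_coef_diffs; apply: (@pseries_snd_diffs _ _ r).
    + by apply: cvg_coef; rewrite gtr0_norm.
    + by rewrite lie_coef_diffs; apply: cvg_coef; rewrite gtr0_norm.
    + by rewrite !lie_coef_diffs; apply: cvg_coef; rewrite gtr0_norm.
    + by rewrite (gtr0_norm r0).
  apply: near_eq_is_derive dPhi.
  near=> s; rewrite evy // ltW //.
  by near: s; apply: (cvgr_norm_lt _ cvg_id).
Unshelve. all: by end_near. Qed.

(** * Points where the projection is a submersion *)

(** A point x with a unique best approximation z determines (x, z). *)
Lemma Omega_fst_injective (R : realType) n (nu : 'rV[R]_n -> R)
    (C : set 'rV[R]_n) (w w' : 'rV[R]_(n + n)) :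
  Omega nu C w -> Omega nu C w' -> lsubmx w = lsubmx w' -> w = w'.
Proof.
move=> [/contrapT[z [_ uniq_z]] best_w] [_ best_w'] eq_x.
rewrite -[w]hsubmxK -[w']hsubmxK eq_x; congr row_mx.
by rewrite -(uniq_z _ best_w); apply: uniq_z; rewrite eq_x.
Qed.

Lemma generic_rank_le (F : fieldType) n (V : irr_variety F n) :
  (generic_rank V <= n)%N.
Proof. by apply/bigmax_leqP => i _; rewrite -ltnS. Qed.

Lemma smooth_point_rank (F : fieldType) n (V : irr_variety F n) y :
  smooth_points V y <-> points V y /\ \rank (Defs.jacobian V y) = generic_rank V.
Proof.
by rewrite /smooth_points /= /variety_dim subKn // generic_rank_le.
Qed.

(** A field tangent to V acts as a derivation preserving the ideal of V. *)
Lemma flow_in_variety (R : realType) n (V : irr_variety R n)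
    (W : 'rV[mpoly n R]_n) :
    (forall x, points V x ->
      map_mx (ev x) (grad_gens V) *m (map_mx (ev x) W)^T = 0) ->
  forall f, (forall x, points V x -> ev x f = 0) ->
  forall k x, points V x -> ev x (iter k (lie W) f) = 0.
Proof.
move=> tanW f f0; elim=> [|k IHk] x Vx //=; first exact: f0.
rewrite ev_lie; have /submxP[c ->] := grad_vanishing Vx IHk.
by rewrite -mulmxA tanW // mulmx0 mxE.
Qed.

(** At a point of Theta where the rank of the gradients of V and of the first
    coordinates is maximal on Theta, the annihilating field is tangent to V and,
    along Theta, to the fibres of the projection. Its flow would move the point
    inside a fibre if that rank were not full. *)
Lemma immersed_point (R : realType) n k (V : irr_variety R (n + k))
    (U : set 'rV[R]_(n + k)) (Theta := U `&` smooth_points V) :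
    open U -> Theta !=set0 ->
    (forall w w', Theta w -> Theta w' -> lsubmx w = lsubmx w' -> w = w') ->
  exists2 y, points V y & \rank (map_mx (ev y) (grad_proj V)) = (n + k)%N.
Proof.
move=> openU [y1 Theta_y1] inj; apply: contrapT => noy.
have lt_rk y : points V y -> (\rank (map_mx (ev y) (grad_proj V)) < n + k)%N.
  move=> Vy; rewrite ltn_neqAle rank_leq_col andbT; apply/eqP => rky.
  by apply: noy; exists y.
pose rkTheta r :=
  `[< exists2 y, Theta y & \rank (map_mx (ev y) (grad_proj V)) = r >].
have ex_rk : exists r, rkTheta r.
  by exists (\rank (map_mx (ev y1) (grad_proj V))); apply/asboolP; exists y1.
have ub_rk r : rkTheta r -> (r <= n + k)%N.
  by move=> /asboolP[y _ <-]; rewrite rank_leq_col.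
have [rho /asboolP[y0 [Uy0 smooth_y0] rk_y0] max_rho] := ex_maxnP ex_rk ub_rk.
have [Vy0 rkJ0] := (smooth_point_rank V y0).1 smooth_y0.
have sAB y : (map_mx (ev y) (grad_gens V) <= map_mx (ev y) (grad_proj V))%MS.
  by rewrite ev_grad_proj submx_col_mxl.
have [W [g [W0 g0 rk_g annA annB]]] :=
  annihilating_field (sAB y0) (lt_rk _ Vy0).
have tanW x : points V x ->
    map_mx (ev x) (grad_gens V) *m (map_mx (ev x) W)^T = 0.
  by move=> Vx; apply: annA; rewrite !rank_grad_gens rkJ0 rank_jacobian_le_generic.
have [r [y [r0 y_0 flow0 flowD]]] := polynomial_flow W y0.
have flowV t : `|t| < r -> points V (y t).
  move=> ltr; have [ps defV] := points_algebraic V; rewrite defV => p psp.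
  apply: (flow0 p) => // l; apply: (flow_in_variety tanW) => // x.
  by rewrite defV => /(_ p psp).
have [j Wj0] : exists j, ev y0 (W 0 j) != 0.
  apply: contrapT => noj; case/eqP: W0; apply/rowP => j; rewrite !mxE.
  by apply: contrapT => /eqP Wj; apply: noj; exists j.
have flow_cont f : {for 0, continuous (fun t : R => ev (y t) f)}.
  apply: differentiable_continuous; apply/derivable1_diffP.
  by have := flowD f 0; rewrite normr0 => /(_ r0) /@ex_derive.
have nearU : \forall t \near (0 : R), U (y t).
  have /nbhs_ballP[e e0 ballU] : nbhs y0 U by apply: open_nbhs_nbhs.
  have : \forall t \near (0 : R), forall l, ball (y0 0 l) e (y t 0 l).
    apply: (@filter_forall R 'I_(n + k)
      (fun l (t : R) => ball (y0 0 l) e (y t 0 l)) (nbhs (0 : R))) => l.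
    have cont_l : {for 0, continuous (fun t : R => y t 0 l)}.
      have -> : (fun t : R => y t 0 l) = fun t => ev (y t) (mpolyX R (mnm1 l)).
        by apply/funext => t; rewrite /ev mevalXU.
      exact: flow_cont.
    rewrite -y_0; apply: cont_l; exact: nbhsx_ballx.
  by apply: filterS => t yt; apply: ballU; split=> // i1 l; rewrite ord1.
have near_neq0 f : ev y0 f != 0 -> \forall t \near (0 : R), ev (y t) f != 0.
  rewrite -y_0 => f0; exact: (cvgr_neq0 _ (flow_cont f) f0).
have [d /= d0 near_d] : \forall t \near (0 : R),
    [/\ `|t| < r, U (y t), ev (y t) g != 0 & ev (y t) (W 0 j) != 0].
  near=> t; split; near: t; [|exact: nearU|exact: near_neq0|exact: near_neq0].
  exact: (cvgr0_norm_lt _ cvg_id).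
have {}near_d t : 0 <= t < d ->
    [/\ `|t| < r, Theta (y t) & ev (y t) (W 0 j) != 0].
  move=> /andP[t_ge0 ltd]; have [] := near_d t.
    by rewrite /ball_ /= sub0r normrN ger0_norm.
  move=> ltr Ut gt Wt; split=> //; split=> //; apply/smooth_point_rank.
  have Vt := flowV _ ltr; split=> //; apply/eqP.
  rewrite eqn_leq rank_jacobian_le_generic //.
  by have := rk_g _ gt; rewrite !rank_grad_gens rkJ0.
(* This is where maximality of the rank is used: y t is again in Theta. *)
have W_fst t : 0 <= t < d -> forall l, ev (y t) (W 0 (lshift k l)) = 0.
  move=> td l; have [_ Th _] := near_d t td.
  have : map_mx (ev (y t)) (grad_proj V) *m (map_mx (ev (y t)) W)^T = 0.
    apply: annB => //; rewrite rk_y0; apply: max_rho.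
    by apply/asboolP; exists (y t).
  rewrite ev_grad_proj mul_col_mx => /(congr1 dsubmx).
  rewrite col_mxKd -[map_mx _ W]hsubmxK tr_row_mx mul_row_col mul1mx mul0mx addr0.
  by move/colP/(_ l); rewrite !mxE.
pose t0 := d / 2.
have t0_gt0 : 0 < t0 by rewrite divr_gt0.
have lt_t0d : t0 < d by rewrite /t0 ltr_pdivrMr // ltr_pMr // ltr1n.
(* The mean value theorem serves twice: the first coordinates are unchanged at
   time t0, but the coordinate j has moved. *)
have mean l : exists2 c, 0 <= c < d & y t0 0 l - y0 0 l = ev (y c) (W 0 l) * t0.
  have deriv t : 0 <= t <= t0 ->
      is_derive t (1 : R) (fun s : R => y s 0 l : R) (ev (y t) (W 0 l)).
    move=> /andP[t_ge0 let0].
    have [|ltr _ _] := near_d t; first by rewrite t_ge0 (le_lt_trans let0).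
    have := flowD (mpolyX R (mnm1 l)) t ltr; rewrite lieX.
    by under eq_fun do rewrite /ev mevalXU.
  have [||c /[!in_itv]/= /andP[c0 ct0]] := MVT t0_gt0
      (f := fun s : R => y s 0 l : R) (df := fun s => ev (y s) (W 0 l)).
  - by move=> t /[!in_itv]/= /andP[t_gt0 ltt0]; apply: deriv; rewrite !ltW.
  - apply: derivable_within_continuous => t /[!in_itv]/= tt0.
    by have /@ex_derive := deriv t tt0.
  - by rewrite subr0 y_0 => ->; exists c => //; rewrite ltW //= (lt_trans ct0).
have zero_d : 0 <= (0 : R) < d by rewrite lexx.
have t0_d : 0 <= t0 < d by rewrite ltW.
have y_t0 : y t0 = y0.
  apply: inj; [by case: (near_d _ t0_d)|by []|apply/rowP => l; rewrite !mxE].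
  have [c cd] := mean (lshift k l); rewrite W_fst // mul0r => /eqP.
  by rewrite subr_eq0 => /eqP.
have [c cd] := mean j; rewrite y_t0 subrr => /esym/eqP.
by rewrite mulf_eq0 (gt_eqF t0_gt0) orbF; case: (near_d c cd) => _ _ /negPf ->.
Unshelve. all: by end_near. Qed.

(** * From real to complex points, and the theorem *)

Lemma ev_map_mpoly (R S : comNzRingType) (f : {rmorphism R -> S}) n
    (p : mpoly n R) (x : 'rV[R]_n) : ev (map_mx f x) (map_mpoly f p) = f (ev x p).
Proof.
elim/mpoly_ring_ind: p => [c|i|p q IHp IHq|p q IHp IHq].
- by rewrite map_mpolyC !evC.
- by rewrite map_mpolyX /ev !mevalXU mxE.
- by rewrite !rmorphD /= IHp IHq.
- by rewrite !rmorphM /= IHp IHq.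
Qed.

Lemma mpoly_re_im (R : rcfType) n (p : mpoly n R[i]) :
  exists pr pi : mpoly n R,
    p = map_mpoly (real_complex R) pr + 'i%C *: map_mpoly (real_complex R) pi.
Proof.
elim/mpolyind: p => [|c m p _ _ [pr [pi ->]]].
  by exists 0, 0; rewrite raddf0 scaler0 addr0.
exists (complex.Re c *: mpolyX R m + pr), (complex.Im c *: mpolyX R m + pi).
rewrite !raddfD /= !map_mpolyZ !map_mpolyX addrACA; congr (_ + _).
by rewrite scalerA -scalerDl -complexE.
Qed.

Lemma re_im_eq0 (R : rcfType) (a b : R) :
  real_complex R a + 'i%C * real_complex R b = 0 -> a = 0 /\ b = 0.
Proof.
move=> ab0; have /= := congr1 (@complex.Re R) ab0.
have /= := congr1 (@complex.Im R) ab0.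
by rewrite !(mul0r, mul1r, subr0, add0r, addr0).
Qed.

Lemma peval_map_complex (R : realType) n (q : mpoly n R) (x : 'rV[R]_n) :
  peval (map_mpoly (real_complex R) q) (map_mx (real_complex R) x) =
  real_complex R (ev x q).
Proof. exact: ev_map_mpoly. Qed.

Lemma pevalDZ (F : fieldType) n (p q : mpoly n F) c x :
  peval (p + c *: q) x = peval p x + c * peval q x.
Proof. by rewrite /peval mevalD mevalZ. Qed.

Lemma re_im_vanish (R : realType) n (p : mpoly n R[i]) (pr pi : mpoly n R)
    (x : 'rV[R]_n) :
    p = map_mpoly (real_complex R) pr + 'i%C *: map_mpoly (real_complex R) pi ->
    peval p (map_mx (real_complex R) x) = 0 ->
  ev x pr = 0 /\ ev x pi = 0.
Proof.
move=> -> p0; apply: re_im_eq0; rewrite -!peval_map_complex.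
exact: etrans (esym (pevalDZ _ _ _ _)) p0.
Qed.

Lemma complexification_real (R : realType) n (V : irr_variety R n) w :
  points V w -> complexification V (map_mx (real_complex R) w).
Proof.
move=> Vw p /mapP[q q_gen ->]; rewrite peval_map_complex.
by rewrite (gens_vanish Vw q_gen) rmorph0.
Qed.

Theorem theorem4p4 (R : realType) (n : nat) (nu : 'rV[R]_n -> R)
    (nu_norm : is_norm nu)
    (nu_semialgebraic : semialgebraic_fun nu)
    (nu_differentiable : differentiable_norm nu)
    (dual_differentiable : differentiable_norm (dual_norm nu))
    (C : irr_variety R n)
    (N M : nat) (leMN : (M <= N)%N)
    (Theta : 'I_N -> set 'rV[R]_(n + n))
    (Theta_stratification :
       smooth_whitney_stratification Theta
         (Omega nu C `\` [set w | Sing C (rsubmx w)]))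
    (V : 'I_M -> irr_variety R (n + n))
    (V_dim : forall i, variety_dim (V i) = n)
    (Theta_open : forall i : 'I_M,
       semialgebraic (Theta (widen_ord leMN i)) /\
       open_in_smooth (V i) (Theta (widen_ord leMN i)))
    (Theta_small : forall i : 'I_N, (M <= i)%N ->
       exists2 d : nat, has_dim (Theta i) d & (d < n)%N) :
  forall i : 'I_M,
    dominating (fun w : 'rV[R[i]]_(n + n) => lsubmx w)
      (complexification (V i)).
Proof.
move=> i; have [partTheta _ _] := Theta_stratification.
have [coverTheta _ Theta_neq0] := partTheta.
have [_ [U openU defTheta]] := Theta_open i.
have inj w w' : Theta (widen_ord leMN i) w -> Theta (widen_ord leMN i) w' ->
    lsubmx w = lsubmx w' -> w = w'.
  have sub_Omega u : Theta (widen_ord leMN i) u -> Omega nu C u.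
    move=> Th_u; suff [] : (Omega nu C `\` [set w0 | Sing C (rsubmx w0)]) u by [].
    by rewrite -coverTheta; exists (widen_ord leMN i).
  by move=> /sub_Omega Ow /sub_Omega; apply: Omega_fst_injective.
have := Theta_neq0 (widen_ord leMN i) I; rewrite defTheta in inj * => neq0.
have [y Vy rk_y] := immersed_point openU neq0 inj.
have le_rk : (generic_rank (V i) <= n)%N.
  have := V_dim i; have := generic_rank_le (V i); rewrite /variety_dim; lia.
have real_dense := fst_dense_of_rank le_rk Vy rk_y.
move=> A [ps ->] subA; rewrite -subTset => x _ p psp.
suff -> : p = 0 by exact: meval0.
have p0 w : points (V i) w ->
    peval p (map_mx (real_complex R) (lsubmx w)) = 0.
  move=> Vw; apply: subA psp; exists (map_mx (real_complex R) w).
    exact: complexification_real.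
  by rewrite map_lsubmx.
have [pr [pi def_p]] := mpoly_re_im p.
have re_im0 w (Vw : points (V i) w) := re_im_vanish def_p (p0 w Vw).
have pr0 : pr = 0 by apply: real_dense => w /re_im0[].
have pi0 : pi = 0 by apply: real_dense => w /re_im0[].
by rewrite def_p pr0 pi0 raddf0 scaler0 addr0.
Qed.
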